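(* Let $u$ and $v$ be standard words. If $v$ is a non-zero corotation of $u$, then $\mathrm{ctype}(v)=\mathrm{ctype}(u)$. If $v$ is a zero corotation of $u$, then $\mathrm{ctype}(v)$ is strictly less than $\mathrm{ctype}(u)$ in dominance order.
   Context: A standard word of length $n$ is a permutation $w=w_1\cdots w_n$ of $1,\dots,n$. Tableaux are in English notation; $\mathrm{rowword}(T)$ is the row reading word (rows read left to right, from the bottom row to the top row); $P(w)$ is the (Schensted row) insertion tableau of a word $w$. Cocharge labeling: the cocharge labeling $w^{\mathrm{cc}}$ of a standard word $w$ is the word of the same length obtained by labeling the numbers of $w$ in increasing order: $1$ is labeled $0$, and if $i$ is labeled $k$, then $i+1$ is labeled $k$ (resp. $k+1$) if $i+1$ appears to the right (resp. left) of $i$ in $w$; the label of $w_j$ is placed in position $j$. Corotation: for a word $w$ and a number $a\neq 1$ such that $wa$ is a standard word, $aw$ is a corotation of $wa$; it is a non-zero corotation (resp. zero corotation) if $a$ is labeled by a number greater than $0$ (resp. by $0$) in the cocharge labeling of $wa$. Catabolizability: for a tableau $T$ with distinct entries and with at least $m$ squares in its first row, $T_{(m)}$ is the subtableau formed by the first $m$ squares of the first row, and the $m$-catabolism is $\mathrm{cat}_m(T)=P(\mathrm{rowword}(T_n)\,\mathrm{rowword}(T_s))$, where $T_n$ is the first row of $T$ with $T_{(m)}$ removed and $T_s$ consists of the remaining rows of $T$. For a partition $\lambda$ of $|T|$ (the number of squares of $T$), $T$ is $\lambda$-catabolizable if its first row has at least $\lambda_1$ squares, $T_{(\lambda_1)}$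 contains the $\lambda_1$ smallest entries of $T$, and $\mathrm{cat}_{\lambda_1}(T)$ is $\widehat\lambda$-catabolizable, where $\lambda=(\lambda_1,\widehat\lambda)$; the empty tableau is $\varnothing$-catabolizable. For a standard Young tableau $T$ there is a unique maximal (in dominance order) partition $\lambda$ such that $T$ is $\lambda$-catabolizable (a known fact); this $\lambda$ is the catabolizability $\mathrm{ctype}(T)$ of $T$. It is also obtained by repeatedly applying $\mathrm{cat}_m$ with the largest $m$ such that the first $m$ entries of the first row are the $m$ smallest entries of the current tableau, and recording the successive values of $m$. For a standard word $w$, $\mathrm{ctype}(w):=\mathrm{ctype}(P(w))$. *)

(* Defs.v *)
From mathcomp Require Import all_boot.
From mathcomp Require Import boolp classical_sets.

Set Implicit Arguments.
Unset Strict Implicit.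
Unset Printing Implicit Defensive.

Definition standard_word (w : seq nat) : bool := perm_eq w (iota 1 (size w)).

(** A tableau in English notation is the sequence of its rows, top row first. *)
Definition tableau := seq (seq nat).

Definition rowword (T : tableau) : seq nat := flatten (rev T).

(** When no entry of [r] exceeds [x], [i = size r] and [set_nth] appends [x] to
    [r]; otherwise [x] bumps the leftmost larger entry into the next row. *)
Fixpoint row_insert (T : tableau) (x : nat) : tableau :=
  if T is r :: T' then
    let i := find (ltn x) r in
    set_nth 0 r i x ::
      (if i < size r then row_insert T' (nth 0 r i) else T')
  else [:: [:: x]].

Definition insertion_tableau (w : seq nat) : tableau := foldl row_insert [::] w.

(** Label of the number [i] (a value, not a position) in the cocharge labeling
    of [w]; the value at [i = 0] is junk. *)
Fixpoint cocharge_label (w : seq nat) (i : nat) : nat :=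
  if i is j.+1 then
    if j == 0 then 0
    else cocharge_label w j + (index i w < index j w)
  else 0.

Definition nonzero_corotation (u v : seq nat) : Prop :=
  exists w a, [/\ a <> 1, standard_word (rcons w a),
    u = rcons w a, v = a :: w & 0 < cocharge_label (rcons w a) a].

Definition zero_corotation (u v : seq nat) : Prop :=
  exists w a, [/\ a <> 1, standard_word (rcons w a),
    u = rcons w a, v = a :: w & cocharge_label (rcons w a) a = 0].

Definition is_partition (n : nat) (la : seq nat) : bool :=
  [&& sorted geq la, 0 \notin la & sumn la == n].

Definition dominance_le (la mu : seq nat) : Prop :=
  sumn la = sumn mu /\ forall k, sumn (take k la) <= sumn (take k mu).

Definition dominance_lt (la mu : seq nat) : Prop :=
  dominance_le la mu /\ la <> mu.

Definition catabolism (m : nat) (T : tableau) : tableau :=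
  insertion_tableau (drop m (head [::] T) ++ rowword (behead T)).

Definition smallest_entries (m : nat) (T : tableau) : seq nat :=
  take m (sort leq (rowword T)).

Fixpoint catabolizable (la : seq nat) (T : tableau) : bool :=
  if la is m :: la' then
    let r := head [::] T in
    [&& m <= size r,
        all (fun x => x \in take m r) (smallest_entries m T)
      & catabolizable la' (catabolism m T)]
  else T == [::].

Definition catabolizable_partition (T : tableau) (la : seq nat) : Prop :=
  is_partition (size (rowword T)) la /\ catabolizable la T.

Definition maximal_catabolizable (T : tableau) (la : seq nat) : Prop :=
  catabolizable_partition T la /\
  forall mu, catabolizable_partition T mu -> dominance_le la mu -> mu = la.

(** For a standard Young tableau exactly one partition is
    [maximal_catabolizable], so the default value is never used there. *)
Definition ctype_tableau (T : tableau) : seq nat :=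
  xget [::] (maximal_catabolizable T).

Definition ctype (w : seq nat) : seq nat := ctype_tableau (insertion_tableau w).

(* Main.v *)
Require Import Defs.
From mathcomp Require Import all_boot.
From mathcomp Require Import boolp classical_sets.
From mathcomp Require Import zify.

Set Implicit Arguments.
Unset Strict Implicit.
Unset Printing Implicit Defensive.

(** Read the cocharge labeling of a word from right to left and build a
    partition [nu], starting from the empty one: a letter [a] is absorbed as a
    new cell of row [a] when this gives a partition, and otherwise [a + 1] is put
    back at the left end of the word.  This "catabolism insertion" computes
    the catabolizability.

    Its result is invariant under Knuth moves of the standard word, although a
    single step is not.  The point is that it is invariant under a coarser
    congruence on label words: any two adjacent labels differing by at least 2
    commute, and labels [a], [a + 1] satisfy the Knuth relations; this congruence
    is compatible with every step.

    So the word may be replaced by the row word of its insertion tableau,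
    for which one pass of the algorithm is a catabolism, and the output is the
    greedy sequence of catabolisms; prefixing a word with a new smallest letter
    adds one cell to the first row of the output, whence the greedy sequence
    dominates all others.  A non-zero corotation is one step of the algorithm
    and leaves the output unchanged.  For a zero corotation [wa -> aw], writing
    [w] as the row word of a tableau and removing its first zero labels reduces
    the comparison of the outputs to a shorter word. *)

(** * Catabolism insertion *)

Definition addable (nu : seq nat) (a : nat) : bool :=
  (a == 0) || (nth 0 nu a < nth 0 nu a.-1).

(* The first component is the label word reversed, so that its last letter is
   at hand. *)
Definition step (s : seq nat * seq nat) : seq nat * seq nat :=
  if s.1 is a :: q then
    if addable s.2 a then (q, incr_nth s.2 a) else (rcons q a.+1, s.2)
  else s.

(** A relation, since termination is only known later, from [output_cons]. As [step] fixes the empty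
    word, every large enough [n] serves. *)
Definition halts (q nu ka : seq nat) : Prop :=
  exists n, iter n step (q, nu) = ([::], ka).

Definition noninc (nu : seq nat) : Prop := forall i, nth 0 nu i.+1 <= nth 0 nu i.

Lemma iter_step_nil n nu : iter n step ([::], nu) = ([::], nu).
Proof. by elim: n => //= n ->. Qed.

Lemma halts_nil nu ka : halts [::] nu ka <-> ka = nu.
Proof.
split=> [[n]|->]; last by exists 0.
by rewrite iter_step_nil => -[].
Qed.


Lemma halts_cons a q nu ka :
  halts (a :: q) nu ka <->
  if addable nu a then halts q (incr_nth nu a) ka else halts (rcons q a.+1) nu ka.
Proof.
split=> [[[|n]]|]; first by [].
  by rewrite iterSr /step /=; case: ifP => _ E; exists n.
by case: ifP => add [n E]; exists n.+1; rewrite iterSr /step /= add.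
Qed.

Lemma halts_inj q nu ka ka' : halts q nu ka -> halts q nu ka' -> ka = ka'.
Proof.
move=> [m Em] [n En].
have : iter (m + n) step (q, nu) = iter (n + m) step (q, nu) by rewrite addnC.
by rewrite iterD En iterD Em !iter_step_nil => -[].
Qed.

Lemma noninc_incr nu a : noninc nu -> addable nu a -> noninc (incr_nth nu a).
Proof.
move=> Hnu Ha i; rewrite !nth_incr_nth.
have := Hnu i; move: Ha; rewrite /addable.
case: a => [|a] /=; first by lia.
by case: (a =P i) => [->|]; case: (a.+1 =P i) => [?|]; case: eqP; lia.
Qed.

Lemma addable_incr_far nu a c : c != a -> c != a.+1 ->
  addable (incr_nth nu a) c = addable nu c.
Proof.
rewrite /addable => ca caS; case: c ca caS => [|c] //= ca caS.
by rewrite !nth_incr_nth [a == c]eq_sym [a == c.+1]eq_sym (negbTE ca) -eqSS (negbTE caS).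
Qed.

Lemma addable_incrS nu a : noninc nu -> addable (incr_nth nu a) a.+1.
Proof.
by move=> Hnu; rewrite /addable /= !nth_incr_nth eqxx; have := Hnu a; case: eqP; lia.
Qed.

(* On reversed label words.  These moves are coarser than Knuth moves: labels at
   distance at least 2 commute without a witness next to them. *)
Variant local : seq nat -> seq nat -> Prop :=
  | LocalFar a c : a.+1 < c -> local [:: a; c] [:: c; a]
  | LocalUp a : local [:: a.+1; a; a.+1] [:: a; a.+1; a.+1]
  | LocalDown a : local [:: a; a.+1; a] [:: a; a; a.+1].

Variant lmove : seq nat -> seq nat -> Prop :=
  Move p u u' t : local u u' \/ local u' u -> lmove (p ++ u ++ t) (p ++ u' ++ t).

Lemma move_sym q q' : lmove q q' -> lmove q' q.
Proof. by case=> p u u' t H; apply: Move; case: H; [right | left]. Qed.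

Lemma move_rcons q q' a : lmove q q' -> lmove (rcons q a) (rcons q' a).
Proof. by case=> p u u' t H; rewrite !rcons_cat; apply: Move. Qed.

(* At the head of the queue, an addable row [a + 1] of [nu] plays the role of the
   missing third letter of a Knuth move. *)
Variant related : seq nat * seq nat -> seq nat * seq nat -> Prop :=
  | RelMove q q' nu : noninc nu -> lmove q q' -> related (q, nu) (q', nu)
  | RelHead a t nu : noninc nu -> addable nu a.+1 ->
      related (a :: a.+1 :: t, nu) (a.+1 :: a :: t, nu)
  | RelHeadSym a t nu : noninc nu -> addable nu a.+1 ->
      related (a.+1 :: a :: t, nu) (a :: a.+1 :: t, nu).

Lemma related_sym s s' : related s s' -> related s' s.
Proof.
case=> [q q' nu Hnu /move_sym|a t nu Hnu Ha|a t nu Hnu Ha].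
- exact: RelMove.
- exact: RelHeadSym.
- exact: RelHead.
Qed.

(** Both runs take the same number of steps until they are compared again; [0 < m] lets
    [halts_related] recurse on the length of the run. *)
Definition progress (s s' : seq nat * seq nat) : Prop :=
  exists2 m, 0 < m & iter m step s = iter m step s' \/
                     related (iter m step s) (iter m step s').

Lemma progress_sym s s' : progress s s' -> progress s' s.
Proof.
by case=> m m0 [E|/related_sym R]; exists m => //; [left | right].
Qed.

(** A new cell in row [a] keeps row [a + 1] addable, and a new cell in row [a + 1] does not affect
    row [a], so the order is immaterial. *)
Lemma progress_head a t nu : noninc nu -> addable nu a.+1 ->
  progress (a :: a.+1 :: t, nu) (a.+1 :: a :: t, nu).
Proof.
move=> Hnu HaS; exists 2 => //; left; rewrite /= /step /= HaS /=.
have E : addable (incr_nth nu a.+1) a = addable nu a.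
  by rewrite addable_incr_far; lia.
rewrite E; case: ifP => Ha /=; last by rewrite HaS.
by rewrite addable_incrS // incr_nthC.
Qed.

(** Rows at distance at least 2 do not interact. If both letters are put back, [a + 1] and [c + 1]
    form a far pair again. *)
Lemma progress_far a c t nu : noninc nu -> a.+1 < c ->
  progress (a :: c :: t, nu) (c :: a :: t, nu).
Proof.
move=> Hnu ac; exists 2 => //; rewrite /= /step /=.
have Ea : addable (incr_nth nu c) a = addable nu a by rewrite addable_incr_far; lia.
have Ec : addable (incr_nth nu a) c = addable nu c by rewrite addable_incr_far; lia.
case Ha: (addable nu a) => /=; case Hc: (addable nu c) => /=;
  rewrite ?Ea ?Ec ?Ha ?Hc /=; try by left.
  by left; rewrite incr_nthC.
right; apply: RelMove => //; rewrite -!cats1 -!catA /=.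
have := @Move t [:: a.+1; c.+1] [:: c.+1; a.+1] [::]; rewrite !cats0; apply.
by left; apply: LocalFar.
Qed.

(** If row [a] or row [a + 1] is addable, one step brings [a], [a + 1] to the head with row [a + 1]
    addable; otherwise all three letters are put back and the move reappears, raised by one. *)
Lemma progress_down a t nu : noninc nu ->
  progress (a :: a.+1 :: a :: t, nu) (a :: a :: a.+1 :: t, nu).
Proof.
move=> Hnu; case Ha: (addable nu a).
  exists 1 => //; right; rewrite /= /step /= Ha.
  by apply: RelHeadSym; [exact: noninc_incr | exact: addable_incrS].
case HaS: (addable nu a.+1).
  by exists 1 => //; right; rewrite /= /step /= Ha; apply: RelHeadSym.
exists 3 => //; right; rewrite /= /step /= Ha /= HaS /= Ha /= HaS /=.
apply: RelMove => //; rewrite -!cats1 -!catA /=.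
have := @Move t [:: a.+1; a.+2; a.+1] [:: a.+1; a.+1; a.+2] [::].
by rewrite !cats0; apply; left; apply: LocalDown.
Qed.

Lemma progress_up a t nu : noninc nu ->
  progress (a.+1 :: a :: a.+1 :: t, nu) (a :: a.+1 :: a.+1 :: t, nu).
Proof.
move=> Hnu; case HaS: (addable nu a.+1).
  exact/progress_sym/progress_head.
case Ha: (addable nu a); exists 3 => //; rewrite /= /step /= ?Ha ?HaS /= ?Ha ?HaS /=.
  have HaS' : addable (incr_nth nu a) a.+1 by exact: addable_incrS.
  (* Rows [a] and [a + 1] had equal length, so once row [a] has grown, row [a + 1] takes just one
     letter; the other one is put back. *)
  left; rewrite HaS' /= ifF //.
  move: HaS (Hnu a); rewrite /addable /= !nth_incr_nth !eqxx.
  by case: eqP; lia.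
rewrite HaS; right; apply: RelMove => //; rewrite -!cats1 -!catA /=.
have := @Move t [:: a.+2; a.+1; a.+2] [:: a.+1; a.+2; a.+2] [::].
by rewrite !cats0; apply; left; apply: LocalUp.
Qed.

Lemma progress_local u u' t nu : noninc nu -> local u u' ->
  progress (u ++ t, nu) (u' ++ t, nu).
Proof.
move=> Hnu [a c ac|a|a] /=.
- exact: progress_far.
- exact: progress_up.
- exact: progress_down.
Qed.

Lemma related_progress s s' : related s s' -> progress s s'.
Proof.
case=> [q q' nu Hnu|a t nu Hnu Ha|a t nu Hnu Ha].
- case=> -[|a p] u u' t H.
    by case: H => /progress_local H; [|apply: progress_sym]; apply: H.
  (* The move is not at the head: both states process the same letter and the move persists. *)
  exists 1 => //; right; rewrite /= /step /=.
  case: ifP => Ha; apply: RelMove => //; first exact: noninc_incr.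
  exact: move_rcons (Move p t H).
- exact: progress_head.
- exact/progress_sym/progress_head.
Qed.

Lemma related_nonnil s s' : related s s' -> s.1 != [::].
Proof.
by case=> [q q' nu Hnu []|//|//] [|? ?] u u' t [[]|[]].
Qed.

Lemma halts_related s s' ka : related s s' -> halts s.1 s.2 ka -> halts s'.1 s'.2 ka.
Proof.
move=> R [n]; rewrite -surjective_pairing.
elim/ltn_ind: n s s' R => n IHn s s' R E.
have [m m0 P] := related_progress R.
have [mn|nm] := leqP m n.
  have E' : iter (n - m) step (iter m step s) = ([::], ka) by rewrite -iterD subnK.
  case: P => [P|P].
    by exists n; rewrite -surjective_pairing -(subnK mn) iterD -P.
  have [|l] := IHn (n - m) _ _ _ P E'; first by rewrite ltn_subrL m0 (leq_trans m0).
  by rewrite -surjective_pairing -iterD => El; exists (l + m); rewrite -surjective_pairing.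
(* A run that ends before [m] steps has an empty word at time [m], whereas related states have
   nonempty words. *)
have E' : iter m step s = ([::], ka) by rewrite -(subnK (ltnW nm)) iterD E iter_step_nil.
case: P => [P|P]; last by have := related_nonnil P; rewrite E'.
by exists m; rewrite -surjective_pairing -P.
Qed.

Lemma halts_move q q' nu ka : noninc nu -> lmove q q' -> halts q nu ka <-> halts q' nu ka.
Proof.
move=> Hnu H; split=> [/(@halts_related (q, nu) (q', nu))|/(@halts_related (q', nu) (q, nu))];
  apply; apply: RelMove => //; exact: move_sym.
Qed.

Lemma halts_head q nu ka : halts q nu ka -> head 0 nu <= head 0 ka.
Proof.
case=> n; elim: n q nu => [|n IHn] q nu; first by case=> _ ->.
rewrite iterSr /step /=; case: q => [|a q]; first exact: IHn.
case: ifP => Ha /IHn //; apply: leq_trans.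
by case: nu {Ha} => [|x nu] //; case: a => [|a] //=.
Qed.

(** In the shifted run row 1 is limited by [K], while the original row 0 grows freely. As that row
    never shrinks and ends with length at most [K], the limit never blocks a cell. *)
Lemma halts_shift K q nu ka : halts q nu ka -> head 0 ka <= K ->
  halts (map S q) (K :: nu) (K :: ka).
Proof.
case=> n; elim: n q nu => [|n IHn] q nu E.
  by case: E => -> -> _; apply/halts_nil.
move: E; rewrite iterSr /step /=; case: q => [|a q] E HK; first exact: IHn.
apply/halts_cons.
have EaS : addable nu a -> addable (K :: nu) a.+1.
  move=> Ha; rewrite /addable /=; case: a E Ha => [|a] //= E _.
  have : halts q (incr_nth nu 0) ka by exists n.
  move/halts_head => H; apply: leq_trans HK; apply: leq_trans H.
  by case: (nu).
have {}EaS : addable (K :: nu) a.+1 = addable nu a.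
  apply/idP/idP => //; rewrite /addable /=; case: (a) => //=.
move: E; rewrite EaS; case: ifP => Ha E; first exact: (IHn _ _ E).
by rewrite -map_rcons; apply: IHn.
Qed.

(** * Knuth moves *)

Inductive knuth : seq nat -> seq nat -> Prop :=
  | knuth_refl w : knuth w w
  | knuth_sym w w' : knuth w w' -> knuth w' w
  | knuth_trans w w' w'' : knuth w w' -> knuth w' w'' -> knuth w w''
  | knuth_yxz p s x y z : x < y -> y < z ->
      knuth (p ++ [:: y; x; z] ++ s) (p ++ [:: y; z; x] ++ s)
  | knuth_xzy p s x y z : x < y -> y < z ->
      knuth (p ++ [:: x; z; y] ++ s) (p ++ [:: z; x; y] ++ s).

Lemma knuth_cat l r w w' : knuth w w' -> knuth (l ++ w ++ r) (l ++ w' ++ r).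
Proof.
elim=> {w w'} [w|w w' _|w w' w'' _ IH1 _ IH2|p s x y z xy yz|p s x y z xy yz].
- exact: knuth_refl.
- exact: knuth_sym.
- exact: knuth_trans IH1 IH2.
- by have := @knuth_yxz (l ++ p) (s ++ r) x y z xy yz; rewrite /= -!catA.
- by have := @knuth_xzy (l ++ p) (s ++ r) x y z xy yz; rewrite /= -!catA.
Qed.

Lemma knuth_catl l w w' : knuth w w' -> knuth (l ++ w) (l ++ w').
Proof. by move/(knuth_cat l [::]); rewrite !cats0. Qed.

Lemma knuth_catr r w w' : knuth w w' -> knuth (w ++ r) (w' ++ r).
Proof. exact: (@knuth_cat [::] r). Qed.

Lemma knuth_perm w w' : knuth w w' -> perm_eq w w'.
Proof.
elim=> {w w'} [w|w w' _|w w' w'' _ IH1 _ IH2|p s x y z xy yz|p s x y z xy yz] //.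
- by rewrite perm_sym.
- exact: perm_trans IH1 IH2.
- by rewrite perm_cat2l perm_cat2r perm_cons (perm_catC [:: x] [:: z]).
- by rewrite perm_cat2l perm_cat2r (perm_catCA [:: x] [:: z] [:: y]).
Qed.

(** * Inverse descents, cocharge labels and Knuth invariance *)

Definition dsc (w : seq nat) (j : nat) : bool := index j.+1 w < index j w.

(** Cocharge label counted from a smallest letter [b] instead of 1, since the letters left by a
    catabolism form an interval starting higher up. *)
Definition lab (b : nat) (w : seq nat) (i : nat) : nat := \sum_(b <= j < i) dsc w j.

(* The offset [e] counts the rows of the partition that are already complete. *)
Definition labels (e b : nat) (w : seq nat) : seq nat :=
  rev [seq e + lab b w i | i <- w].

Lemma dsc_swap (p s : seq nat) (x z j : nat) : uniq (p ++ [:: x; z] ++ s) -> x.+1 < z ->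
  dsc (p ++ [:: x; z] ++ s) j = dsc (p ++ [:: z; x] ++ s) j.
Proof.
rewrite cat_uniq => /and3P[_ Hp _] xz; rewrite /dsc /= !index_cat /=.
have ip k : k \in p -> index k p < size p by rewrite index_mem.
have px : x \notin p by apply: contra Hp => Hx /=; rewrite Hx.
have pz : z \notin p by apply: contra Hp => Hz /=; rewrite Hz orbT.
case Ej: (j \in p); case EjS: (j.+1 \in p) => //.
- by have := ip _ Ej; repeat case: eqP; lia.
- by have := ip _ EjS; repeat case: eqP; lia.
by repeat case: eqP; lia.
Qed.

(** A Knuth move exchanges neighbours [x] and [z] with [y] strictly between in value, hence never
    two consecutive numbers. *)
Lemma knuth_dsc w w' : knuth w w' -> uniq w -> dsc w =1 dsc w'.
Proof.
elim=> {w w'} [w|w w' K IH|w w' w'' K1 IH1 K2 IH2|p s x y z xy yz|p s x y z xy yz] // Uw j.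
- by rewrite IH // (perm_uniq (knuth_perm K)).
- by rewrite IH1 // IH2 // -(perm_uniq (knuth_perm K1)).
- have := @dsc_swap (rcons p y) s x z j; rewrite !cat_rcons /=.
  by apply=> //; exact: leq_ltn_trans xy yz.
- by have := @dsc_swap p (y :: s) x z j; apply=> //; exact: leq_ltn_trans xy yz.
Qed.

Lemma eq_lab b w w' : dsc w =1 dsc w' -> lab b w =1 lab b w'.
Proof. by move=> E i; apply: eq_bigr => j _; rewrite E. Qed.

Lemma labS b w i : b <= i -> lab b w i.+1 = lab b w i + dsc w i.
Proof. by move=> bi; rewrite /lab big_nat_recr. Qed.

Lemma lab_geq b w i : i <= b -> lab b w i = 0.
Proof. exact: big_geq. Qed.

Lemma leq_lab b w i k : b <= i -> i <= k -> lab b w i <= lab b w k.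
Proof. by move=> bi ik; rewrite /lab (@big_cat_nat _ _ _ i b k) //= leq_addr. Qed.

(** Going up through the values from [x] to [y] leads to a position further left, so some step is an
    inverse descent. *)
Lemma ltn_lab b w x y : b <= x -> x < y -> index y w < index x w ->
  lab b w x < lab b w y.
Proof.
move=> bx xy; elim: y xy => // y IHy; rewrite ltnS leq_eqVlt => /orP[/eqP<- H|xy H].
  by rewrite labS // /dsc H addn1.
rewrite labS; last by lia.
have [Hy|Hy] := ltnP (index y w) (index x w); first by have := IHy xy Hy; lia.
have := leq_lab w bx (ltnW xy); rewrite /dsc (leq_trans H Hy); lia.
Qed.

(** Either the labels of [x] and [z] differ by at least 2 and commute, or the inequalities force
    [f y = f z = f x + 1], which is a [LocalUp] move. *)
Lemma halts_map_yxz e p s (f : nat -> nat) (x y z : nat) nu ka : noninc nu ->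
  f x <= f z -> f x < f y <= f z ->
  halts (rev [seq e + f i | i <- p ++ [:: y; x; z] ++ s]) nu ka <->
  halts (rev [seq e + f i | i <- p ++ [:: y; z; x] ++ s]) nu ka.
Proof.
move=> Hnu xz /andP[xy yz]; rewrite !map_cat !rev_cat.
set P := rev (map _ s); set Q := rev (map _ p); rewrite -!catA /rev /=.
have [far|near] := ltnP (f x).+1 (f z).
  apply: halts_move => //; apply: (@Move P [:: e + f z; e + f x] [:: e + f x; e + f z]
    (e + f y :: Q)).
  by right; apply: LocalFar; lia.
have -> : e + f y = (e + f x).+1 by lia.
have -> : e + f z = (e + f x).+1 by lia.
apply: halts_move => //; apply: (@Move P [:: (e + f x).+1; e + f x; (e + f x).+1]
   [:: e + f x; (e + f x).+1; (e + f x).+1] Q).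
by left; apply: LocalUp.
Qed.

Lemma halts_map_xzy e p s (f : nat -> nat) (x y z : nat) nu ka : noninc nu ->
  f x <= f y < f z ->
  halts (rev [seq e + f i | i <- p ++ [:: x; z; y] ++ s]) nu ka <->
  halts (rev [seq e + f i | i <- p ++ [:: z; x; y] ++ s]) nu ka.
Proof.
move=> Hnu /andP[xy yz]; rewrite !map_cat !rev_cat.
set P := rev (map _ s); set Q := rev (map _ p); rewrite -!catA /rev /=.
have [far|near] := ltnP (f x).+1 (f z).
  have := @Move (P ++ [:: e + f y]) [:: e + f z; e + f x] [:: e + f x; e + f z] Q.
  rewrite -!catA => H; apply: halts_move => //; apply: H.
  by right; apply: LocalFar; lia.
have -> : e + f y = e + f x by lia.
have -> : e + f z = (e + f x).+1 by lia.
apply: halts_move => //; apply: (@Move P [:: e + f x; (e + f x).+1; e + f x]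
   [:: e + f x; e + f x; (e + f x).+1] Q).
by left; apply: LocalDown.
Qed.

Lemma halts_knuth e b w w' nu ka : noninc nu -> knuth w w' -> uniq w -> all (leq b) w ->
  halts (labels e b w) nu ka <-> halts (labels e b w') nu ka.
Proof.
move=> Hnu; elim=> {w w'} [w|w w' K IH|w w' w'' K1 IH1 K2 IH2|p s x y z xy yz|p s x y z xy yz] // Uw Bw.
- by rewrite IH // ?(perm_uniq (knuth_perm K)) ?(perm_all _ (knuth_perm K)).
- by rewrite IH1 // IH2 // -?(perm_uniq (knuth_perm K1)) -?(perm_all _ (knuth_perm K1)).
- have [bx bz] : b <= x /\ b <= z by move: Bw; rewrite !all_cat /=; lia.
  rewrite /labels.
  (* Each letter has the same label in both words, so the move only permutes labels. *)
  have /eq_map -> : (fun i => e + lab b (p ++ [:: y; z; x] ++ s) i) =1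
                    (fun i => e + lab b (p ++ [:: y; x; z] ++ s) i).
    by move=> i; rewrite -(eq_lab b (knuth_dsc (knuth_yxz p s xy yz) Uw)).
  apply: halts_map_yxz => //; first by apply: leq_lab; lia.
  rewrite (leq_lab _ (leq_trans bx (ltnW xy)) (ltnW yz)) andbT.
  apply: ltn_lab => //; move: Uw; rewrite cat_uniq /= !index_cat /= => /and3P[_ Hp _].
  move: Hp; rewrite !negb_or => /and4P[/negbTE-> /negbTE-> _ _].
  by repeat case: eqP; lia.
- have [bx bz] : b <= x /\ b <= z by move: Bw; rewrite !all_cat /=; lia.
  rewrite /labels.
  have /eq_map -> : (fun i => e + lab b (p ++ [:: z; x; y] ++ s) i) =1
                    (fun i => e + lab b (p ++ [:: x; z; y] ++ s) i).
    by move=> i; rewrite -(eq_lab b (knuth_dsc (knuth_xzy p s xy yz) Uw)).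
  apply: halts_map_xzy => //; rewrite (leq_lab _ bx (ltnW xy)).
  apply: ltn_lab => //; first by lia.
  move: Uw; rewrite cat_uniq /= !index_cat /= => /and3P[_ Hp _].
  move: Hp; rewrite !negb_or => /and4P[_ /negbTE-> /negbTE-> _].
  by repeat case: eqP; lia.
Qed.

(** * Row insertion *)

Lemma leq_last_path y r : path ltn y r -> y <= last y r.
Proof.
elim: r y => //= t r IHr y /andP[yt Pt].
exact: leq_trans (ltnW yt) (IHr _ Pt).
Qed.

(** [x] passes the letters of [r] from the right, each time with the preceding letter of the row as
    witness. *)
Lemma knuth_pull_right x y r : x < y -> path ltn y r ->
  knuth (y :: rcons r x) [:: y, x & r].
Proof.
elim/last_ind: r => [|r z IHr] xy; first by move=> _; apply: knuth_refl.
rewrite rcons_path => /andP[Pr Hz].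
have xl : x < last y r := leq_trans xy (leq_last_path Pr).
apply: (@knuth_trans _ (rcons (y :: rcons r x) z)); last first.
  by have := knuth_catr [:: z] (IHr xy Pr); rewrite !cats1.
rewrite -!rcons_cons lastI.
by rewrite -!cats1 -!catA; exact/knuth_sym/(@knuth_yxz _ [::]).
Qed.

(** [y] passes the letters of [r] leftwards, the witness being the letter that follows: the next one
    of [r], or [x]. *)
Lemma knuth_pull_left x y r : all (gtn x) r -> x < y -> sorted ltn r ->
  knuth (r ++ [:: y; x]) (y :: rcons r x).
Proof.
elim: r => [|l r IHr] /=; first by move=> _ _ _; apply: knuth_refl.
move=> /andP[lx Hr] xy Pr.
apply: knuth_trans (knuth_catl [:: l] (IHr Hr xy (path_sorted Pr))) _ => /=.
case: r Hr Pr {IHr} => [|h r] /=; first by move=> _ _; exact: (@knuth_xzy [::] [::]).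
move=> /andP[hx _] /andP[lh _].
by apply: (@knuth_xzy [::] (rcons r x)) => //; exact: ltn_trans hx xy.
Qed.

Lemma knuth_bump r1 y r2 x : all (gtn x) r1 -> x < y -> sorted ltn (r1 ++ y :: r2) ->
  knuth (r1 ++ y :: r2 ++ [:: x]) (y :: r1 ++ x :: r2).
Proof.
move=> H1 xy; rewrite -cat_rcons => Hs.
have S1 : sorted ltn r1.
  by move: Hs; rewrite cat_rcons => /(subseq_sorted ltn_trans (prefix_subseq _ _)).
have P2 : path ltn y r2.
  by move: Hs; rewrite cat_rcons => /(subseq_sorted ltn_trans (suffix_subseq _ _)).
apply: knuth_trans (knuth_catl r1 _) _.
  by rewrite -cat_cons cats1; exact: knuth_pull_right.
by have := knuth_catr r2 (knuth_pull_left H1 xy S1); rewrite /= -!catA cat_rcons.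
Qed.

Lemma row_insert_cases r T x : sorted ltn r -> x \notin r ->
  (all (gtn x) r /\ row_insert (r :: T) x = rcons r x :: T) \/
  (exists r1 y r2, [/\ r = r1 ++ y :: r2, all (gtn x) r1, x < y &
     row_insert (r :: T) x = (r1 ++ x :: r2) :: row_insert T y]).
Proof.
move=> Sr xr /=; set i := find _ _.
have Hi : all (gtn x) (take i r).
  apply/allP=> z Hz; have [] := ltngtP z x => //; last first.
    by move=> E; move: xr; rewrite -E (mem_take Hz).
  move=> xz; move: (index_mem z (take i r)); rewrite Hz size_take_min => iz.
  have : ~~ ltn x (nth 0 r (index z (take i r))).
    by apply/negbT/before_find; exact: leq_trans iz (geq_minl _ _).
  by rewrite -(nth_take 0 (leq_trans iz (geq_minl _ _))) nth_index //= xz.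
have [ir|ri] := ltnP i (size r); last first.
  have Ei : i = size r by apply/eqP; rewrite eqn_leq ri find_size.
  left; rewrite Ei in Hi *; rewrite take_size in Hi; split=> //.
  by rewrite set_nthE ltnn subnn /= cats1.
right; exists (take i r), (nth 0 r i), (drop i.+1 r); split=> //.
- by rewrite -drop_nth // cat_take_drop.
- by apply: (@nth_find _ 0 (ltn x)); rewrite has_find.
- by rewrite set_nthE ir.
Qed.

Definition above (r s : seq nat) : Prop :=
  size s <= size r /\ forall i, i < size s -> nth 0 r i < nth 0 s i.

Fixpoint is_tableau (T : tableau) : Prop :=
  if T is r :: T' then
    [/\ r != [::], sorted ltn r, above r (head [::] T') & is_tableau T']
  else True.

Lemma head_row_insert T x : head [::] (row_insert T x) =
  set_nth 0 (head [::] T) (find (ltn x) (head [::] T)) x.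
Proof. by case: T. Qed.

(** The entry of [s] below [y], if any, exceeds [y], so [y] lands weakly to the left of its old
    column; there it lies under [x] or under an entry of [r] smaller than [y]. *)
Lemma above_bump r s x : sorted ltn r -> above r s ->
  let i := find (ltn x) r in let y := nth 0 r i in i < size r ->
  above (set_nth 0 r i x) (set_nth 0 s (find (ltn y) s) y).
Proof.
move=> Sr [ss Hs] i y ir.
have xy : x < y by apply: (@nth_find _ 0 (ltn x)); rewrite has_find.
set i' := find (ltn y) s.
have i'i : i' <= i.
  have [si|is_] := leqP (size s) i; first exact: leq_trans (find_size _ _) si.
  rewrite leqNgt; apply/negP => /(before_find 0) /=.
  by rewrite (Hs _ is_).
split=> [|j]; first by rewrite !size_set_nth !geq_max; lia.
rewrite size_set_nth !nth_set_nth /= => Hj.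
have [->|ji'] := eqVneq j i'.
  have [//|ne] := eqVneq i' i.
  by apply: (sorted_ltn_nth ltn_trans) => //; rewrite ?inE /=; lia.
have {}Hj : j < size s by have : i' <= size s := find_size _ _; lia.
have := Hs _ Hj; case: eqP => [->|//]; exact: ltn_trans.
Qed.

Lemma rowword_cons r T : rowword (r :: T) = rowword T ++ r.
Proof. by rewrite /rowword rev_cons flatten_rcons. Qed.

Lemma knuth_row_insert T x : is_tableau T -> uniq (rcons (rowword T) x) ->
  knuth (rowword (row_insert T x)) (rcons (rowword T) x).
Proof.
elim: T x => [|r T IHT] x; first by move=> _ _; apply: knuth_refl.
rewrite rowword_cons rcons_uniq mem_cat negb_or cat_uniq.
move=> [r0 Sr Or HT] /andP[/andP[xT xr] /and3P[UT rT Ur]].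
have [[Hx ->]|[r1 [y [r2 [Er H1 xy ->]]]]] := row_insert_cases T Sr xr.
  by rewrite rowword_cons rcons_cat; apply: knuth_refl.
have yT : y \notin rowword T.
  apply: contra rT => yT; apply/hasP; exists y => //.
  by rewrite Er mem_cat mem_head orbT.
rewrite rowword_cons; apply: knuth_trans (knuth_catr _ (IHT y HT _)) _.
  by rewrite rcons_uniq yT.
rewrite cat_rcons rcons_cat Er -cats1 -catA; apply/knuth_catl/knuth_sym.
by apply: knuth_bump => //; rewrite -Er.
Qed.

Lemma is_tableau_insert T x : is_tableau T -> uniq (rcons (rowword T) x) ->
  is_tableau (row_insert T x).
Proof.
elim: T x => [|r T IHT] x; first by [].
rewrite rowword_cons rcons_uniq mem_cat negb_or cat_uniq.
move=> [r0 Sr Or HT] /andP[/andP[xT xr] /and3P[UT rT Ur]].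
have [[Hx ->]|[r1 [y [r2 [Er H1 xy E]]]]] := row_insert_cases T Sr xr.
  split=> //; first by case: (r).
    move: r0 Sr Hx; case: (r) => [|z s] //= _ Sr Hx; rewrite rcons_path Sr.
    exact: (allP (Hx : all (gtn x) (z :: s)) _ (mem_last z s)).
  case: Or => Os Ho; split=> [|i Hi]; first by rewrite size_rcons ltnW.
  by rewrite nth_rcons (leq_trans Hi Os) Ho.
have yT : y \notin rowword T.
  apply: contra rT => yT; apply/hasP; exists y => //.
  by rewrite Er mem_cat mem_head orbT.
have Ef : find (ltn x) r = size r1.
  rewrite Er find_cat /= ifF ?xy ?addn0 //.
  by apply/negP=> /hasP[z /(allP H1) /=]; lia.
have ir : find (ltn x) r < size r by rewrite Ef Er size_cat /=; lia.
have Ey : nth 0 r (find (ltn x) r) = y by rewrite Ef Er nth_cat ltnn subnn.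
have Er' : set_nth 0 r (find (ltn x) r) x = r1 ++ x :: r2.
  by move: E => /= [-> _].
have := above_bump Sr Or ir; rewrite Er' Ey -head_row_insert => Or'.
rewrite E; split=> //.
- by case: (r1).
- move: Sr; rewrite Er -!cat_rcons.
  case: r1 H1 {Er Ef E Er' Or'} => [|z r1] /= H1.
    by case: (r2) => //= t r2' /andP[yt ->]; rewrite (ltn_trans xy yt).
  rewrite !cat_path !rcons_path !last_rcons => /andP[/andP[-> _] P2].
  have lx : last z r1 < x := allP (H1 : all (gtn x) (z :: r1)) _ (mem_last z r1).
  rewrite /= lx /=.
  by case: (r2) P2 => //= t r2' /andP[yt ->]; rewrite (ltn_trans xy yt).
- by apply: IHT => //; rewrite rcons_uniq yT.
Qed.

Lemma insertion_tableau_rcons w x :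
  insertion_tableau (rcons w x) = row_insert (insertion_tableau w) x.
Proof. by rewrite /insertion_tableau -cats1 foldl_cat. Qed.

Lemma insertion_tableauP w : uniq w ->
  is_tableau (insertion_tableau w) /\ knuth (rowword (insertion_tableau w)) w.
Proof.
elim/last_ind: w => [|w x IHw]; first by move=> _; split=> //; exact: knuth_refl.
move=> U; have [HT Kw] : is_tableau (insertion_tableau w) /\
    knuth (rowword (insertion_tableau w)) w.
  by apply: IHw; move: U; rewrite rcons_uniq => /andP[].
have U' : uniq (rcons (rowword (insertion_tableau w)) x).
  by move: U; rewrite !rcons_uniq (perm_uniq (knuth_perm Kw)) (perm_mem (knuth_perm Kw)).
rewrite insertion_tableau_rcons; split; first exact: is_tableau_insert.
apply: knuth_trans (knuth_row_insert HT U') _.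
by rewrite -!cats1; exact: knuth_catr.
Qed.

(** * Cocharge labels under corotation *)

Definition interval_word (b : nat) (w : seq nat) : bool :=
  perm_eq w (iota b (size w)).

Definition output (b : nat) (w ka : seq nat) : Prop :=
  halts (labels 0 b w) [::] ka.

Lemma index_in_iota b n i : b <= i < b + n -> index i (iota b n) = i - b.
Proof.
move=> /andP[bi Hi]; rewrite -{1}(subnKC bi) -(@nth_iota 0 b n) ?ltn_subLR //.
by rewrite index_uniq ?iota_uniq // size_iota ltn_subLR.
Qed.

Lemma map_const_in (T : eqType) (T' : Type) (f : T -> T') e s : {in s, f =1 fun=> e} ->
  map f s = nseq (size s) e.
Proof.
elim: s => //= x s IHs H; rewrite H ?mem_head // IHs // => y Hy.
by rewrite H // inE Hy orbT.
Qed.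

Section IntervalWord.
Variables (b : nat) (w : seq nat).
Hypothesis Hw : interval_word b w.

Lemma interval_word_uniq : uniq w.
Proof. by rewrite (perm_uniq Hw) iota_uniq. Qed.

Lemma mem_interval_word i : (i \in w) = (b <= i < b + size w).
Proof. by rewrite (perm_mem Hw) mem_iota. Qed.

Lemma interval_word_ge : all (leq b) w.
Proof. by apply/allP=> i; rewrite mem_interval_word => /andP[]. Qed.

Lemma interval_word_perm w' : perm_eq w' w -> interval_word b w'.
Proof.
by move=> E; rewrite /interval_word (perm_size E); exact: perm_trans E Hw.
Qed.

End IntervalWord.

Lemma interval_word_iota_catr b j R :
  interval_word b (R ++ iota b j) = interval_word (b + j) R.
Proof.
by rewrite /interval_word size_cat size_iota addnC iotaD perm_catC perm_cat2l.
Qed.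

Lemma interval_word_iota_catl b j R :
  interval_word b (iota b j ++ R) = interval_word (b + j) R.
Proof. by rewrite /interval_word size_cat size_iota iotaD perm_cat2l. Qed.

Lemma interval_word_cons b R : interval_word b (b :: R) = interval_word b.+1 R.
Proof. by rewrite -addn1 -(interval_word_iota_catl b 1). Qed.

(** Telescoping: the descent indicators differ by the increments of [d]. *)
Lemma lab_compare b n w w' (d : nat -> nat) :
  (forall i, b <= i -> i.+1 < b + n -> d i + dsc w' i = dsc w i + d i.+1) ->
  forall i, b <= i < b + n -> d b + lab b w' i = lab b w i + d i.
Proof.
move=> H i /andP[]; elim: i => [|i IHi].
  by rewrite leqn0 => /eqP-> _; rewrite !lab_geq ?addn0.
rewrite leq_eqVlt => /orP[/eqP-> _|bi Hi]; first by rewrite !lab_geq ?addn0.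
by rewrite !labS //; have := H i bi Hi; have := IHi bi (ltnW Hi); lia.
Qed.

(** Moving [a] from the end to the front creates the inverse descent [a - 1] and destroys [a], so
    only the label of [a] changes. *)
Lemma lab_corotation b w a i : interval_word b (rcons w a) -> a != b ->
  i \in rcons w a -> lab b (a :: w) i = lab b (rcons w a) i + (i == a).
Proof.
move=> Hw ab; rewrite (mem_interval_word Hw) => Hi.
have := @lab_compare b (size (rcons w a)) (rcons w a) (a :: w) (fun i => i == a).
rewrite /= [b == a]eq_sym (negbTE ab) => H; rewrite -[LHS]add0n H // => {H} k bk Hk.
have Uw := interval_word_uniq Hw.
have [kw kSw] : k \in rcons w a /\ k.+1 \in rcons w a.
  by rewrite !(mem_interval_word Hw); lia.
move: kw kSw Uw; rewrite !mem_rcons !inE rcons_uniq /dsc -cats1 /= !index_cat /=.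
rewrite ![a == _]eq_sym.
have Ik x : x \in w -> index x w < size w by rewrite index_mem.
case: eqP => [->|ka] /=; case: eqP => [->|kSa] //= Hk1 Hk2 /andP[aw Uw].
- lia.
- by have := Ik _ Hk2; rewrite Hk2 (negbTE aw); lia.
- by have := Ik _ Hk1; rewrite Hk1 (negbTE aw); lia.
- by rewrite Hk1 Hk2; lia.
Qed.

Lemma halts_corotation e K b w a ka : interval_word b (rcons w a) ->
  0 < lab b (rcons w a) a ->
  halts (labels e b (rcons w a)) (nseq e K) ka <->
  halts (labels e b (a :: w)) (nseq e K) ka.
Proof.
move=> Hw Ha.
have ab : a != b by apply: contraTneq Ha => ->; rewrite lab_geq.
(* Row [e + lab b (rcons w a) a] and the row before it both lie beyond the [e] rows present, so the
   letter is not addable and is put back. *)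
rewrite /labels map_rcons rev_rcons halts_cons ifF; last first.
  by rewrite /addable addn_eq0 [lab _ _ _ == 0]eqn0Ngt Ha andbF !nth_nseq !ifF //; lia.
rewrite /= rev_cons lab_corotation // ?mem_rcons ?mem_head // eqxx addn1 addnS.
have /eq_in_map-> // : {in w, (fun i => e + lab b (a :: w) i) =1
                            (fun i => e + lab b (rcons w a) i)}.
move=> i iw; rewrite lab_corotation // ?mem_rcons ?inE ?iw ?orbT //.
have := interval_word_uniq Hw; rewrite rcons_uniq => /andP[aw _].
by case: eqP iw aw => [->->|]; rewrite ?addn0.
Qed.

Lemma halts_corotations e K b A B ka : interval_word b (A ++ B) ->
  all (fun i => 0 < lab b (A ++ B) i) B ->
  halts (labels e b (A ++ B)) (nseq e K) ka <->
  halts (labels e b (B ++ A)) (nseq e K) ka.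
Proof.
elim/last_ind: B A => [|B x IHB] A Hw HB; first by rewrite cats0.
move: Hw HB; rewrite -rcons_cat all_rcons => Hw /andP[Hx HB].
rewrite halts_corotation // cat_rcons -(IHB (x :: A)) //.
  by apply: (interval_word_perm Hw); rewrite perm_sym perm_rcons.
apply/allP=> i Hi; have := allP HB _ Hi; rewrite /= lab_corotation //; first by lia.
  by apply: contraTneq Hx => ->; rewrite lab_geq.
by rewrite mem_rcons inE mem_cat Hi !orbT.
Qed.

Lemma lab_cat b c w i : b <= c -> c <= i -> lab b w i = lab b w c + lab c w i.
Proof. by move=> bc ci; rewrite /lab (@big_cat_nat _ _ _ c). Qed.

Lemma eq_lab_in c n w w' i : (forall k, c <= k -> k.+1 < c + n -> dsc w k = dsc w' k) ->
  i < c + n -> lab c w i = lab c w' i.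
Proof. by move=> H Hi; apply: eq_big_nat => k Hk; rewrite H; lia. Qed.

Lemma lab0 b w i : (forall k, b <= k -> k.+1 <= i -> ~~ dsc w k) -> lab b w i = 0.
Proof.
move=> H; rewrite /lab big_nat big1 // => k /andP[bk ki].
by rewrite (negbTE (H _ bk ki)).
Qed.

(** [b + j] stands to the left of [b + j - 1], which raises every label of [R] by one. With the run
    in front, as in [labels_iota_catl], nothing is raised. *)
Lemma labels_iota_catr e b j R : 0 < j -> interval_word (b + j) R ->
  labels e b (R ++ iota b j) = nseq j e ++ labels e.+1 (b + j) R.
Proof.
move=> j0 HR; have mR := mem_interval_word HR.
have L0 i : i < b + j -> lab b (R ++ iota b j) i = 0.
  by move=> Hi; apply: lab0 => k bk ki; rewrite /dsc !index_cat !mR !ifF ?index_in_iota //; lia.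
rewrite /labels map_cat rev_cat; congr (_ ++ _).
  rewrite (@map_const_in _ _ _ e) ?size_iota ?rev_nseq // => i.
  by rewrite mem_iota => /andP[_ /L0->]; rewrite addn0.
congr rev; apply/eq_in_map => i Hi; rewrite addSnnS; congr (_ + _).
rewrite (@lab_cat b (b + j)) ?leq_addr //; last by move: Hi; rewrite mR; lia.
rewrite -[(lab _ R _).+1]add1n; congr (_ + _); last first.
  apply: (@eq_lab_in _ (size R)); last by move: Hi; rewrite mR; lia.
  by move=> k Hk1 Hk2; rewrite /dsc !index_cat !mR !ifT //; lia.
case: j j0 HR mR L0 Hi => // j _ HR mR L0 Hi; rewrite addnS labS ?leq_addr // L0; last by lia.
rewrite add0n.
rewrite /dsc -addnS !index_cat !mR ifT ?ifF; try by move: Hi; rewrite mR; lia.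
by rewrite ltn_addr // index_mem mR; move: Hi; rewrite mR; lia.
Qed.

Lemma labels_iota_catl e b j R : interval_word (b + j) R ->
  labels e b (iota b j ++ R) = labels e (b + j) R ++ nseq j e.
Proof.
move=> HR; have mR := mem_interval_word HR.
have L0 i : i <= b + j -> i < b + j + size R -> lab b (iota b j ++ R) i = 0.
  move=> Hi HiR; apply: lab0 => k bk ki; rewrite /dsc !index_cat !mem_iota size_iota.
  have -> : b <= k < b + j by lia.
  by case: ifP => H; rewrite !index_in_iota; lia.
rewrite /labels map_cat rev_cat; congr (_ ++ _); last first.
  rewrite (@map_const_in _ _ _ e) ?size_iota ?rev_nseq // => i.
  by rewrite mem_iota => /andP[_ Hi]; rewrite L0 ?addn0 //; lia.
congr rev; apply/eq_in_map => i; rewrite mR => /andP[Hi1 Hi2]; congr (_ + _).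
rewrite (@lab_cat b (b + j)) ?leq_addr // L0 ?add0n //; last by lia.
apply: (@eq_lab_in _ (size R)) => // k Hk1 Hk2.
by rewrite /dsc !index_cat !mem_iota !ifF ?size_iota; lia.
Qed.

(** * Absorbing runs of equal labels *)

Lemma halts_zeros j Q x nu ka :
  halts (nseq j 0 ++ Q) (x :: nu) ka <-> halts Q (x + j :: nu) ka.
Proof.
elim: j x => [|j IHj] x; first by rewrite addn0.
by rewrite /= halts_cons /= IHj addSnnS.
Qed.

Lemma halts_zeros_nil j Q ka : 0 < j ->
  halts (nseq j 0 ++ Q) [::] ka <-> halts Q [:: j] ka.
Proof. by case: j => // j _; rewrite /= halts_cons /= halts_zeros add1n. Qed.

Lemma halts_ones K x j Q ka : x + j <= K ->
  halts (nseq j 1 ++ Q) [:: K; x] ka <-> halts Q [:: K; x + j] ka.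
Proof.
elim: j x => [|j IHj] x H; first by rewrite addn0.
by rewrite /= halts_cons /addable /= ifT ?IHj ?addSnnS //; lia.
Qed.

Lemma halts_ones_full K j Q ka :
  halts (nseq j 1 ++ Q) [:: K; K] ka <-> halts (Q ++ nseq j 2) [:: K; K] ka.
Proof.
elim: j Q => [|j IHj] Q; first by rewrite cats0.
by rewrite /= halts_cons /addable /= ltnn rcons_cat IHj cat_rcons.
Qed.

Lemma halts_ones_cut K j Q ka : 0 < K -> K <= j ->
  halts (nseq j 1 ++ Q) [:: K] ka <-> halts (Q ++ nseq (j - K) 2) [:: K; K] ka.
Proof.
case: K => // K _ Kj; rewrite -{1}(subnKC Kj) nseqD -catA /= halts_cons /=.
by rewrite halts_ones // add1n halts_ones_full.
Qed.

Lemma output_iota_catr b j R ka : 0 < j -> interval_word (b + j) R ->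
  output b (R ++ iota b j) ka <-> halts (labels 1 (b + j) R) [:: j] ka.
Proof. by move=> j0 HR; rewrite /output labels_iota_catr // halts_zeros_nil. Qed.

Lemma labels_map_S e b w : map S (labels e b w) = labels e.+1 b w.
Proof. by rewrite /labels map_rev -map_comp. Qed.

(** * Catabolism *)

(** For the first row of a tableau with smallest entry [b], this is the largest [m] allowed in a
    catabolism (see [smallest_entries_run]). *)
Fixpoint run_length (b : nat) (r : seq nat) : nat :=
  if r is x :: r' then if x == b then (run_length b.+1 r').+1 else 0 else 0.

Lemma leq_run_length b r k :
  (k <= run_length b r) = (k <= size r) && (take k r == iota b k).
Proof.
elim: r b k => [|x r IHr] b [|k] //=.
rewrite eqseq_cons; case: (x =P b) => _; rewrite ?andbF //=.
by rewrite !ltnS IHr.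
Qed.

Lemma run_length_cat b r :
  r = iota b (run_length b r) ++ drop (run_length b r) r.
Proof.
have := leq_run_length b r (run_length b r).
by rewrite leqnn => /esym/andP[_ /eqP<-]; rewrite cat_take_drop.
Qed.

Lemma take_sorted_iota c k r : sorted ltn r -> all (leq c) r ->
  (forall i, c <= i < c + k -> i \in r) -> k <= size r /\ take k r = iota c k.
Proof.
elim: k c r => [|k IHk] c r; first by rewrite take0.
case: r => [|x r] /= Sr; first by move=> _ /(_ c); rewrite in_nil; lia.
move=> /andP[cx Hc] H; have xr : all (ltn x) r := order_path_min ltn_trans Sr.
have Ex : x = c.
  have : c \in x :: r by apply: H; lia.
  by rewrite inE => /orP[/eqP//|/(allP xr) /=]; lia.
rewrite {x cx}Ex in Sr xr H *.
have [||i Hi|Hs ->] := IHk c.+1 r => //; first exact: path_sorted Sr.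
have : i \in c :: r by apply: H; lia.
by rewrite inE => /orP[/eqP|//]; lia.
Qed.

Lemma tableau_min T i : is_tableau T -> i \in rowword T -> nth 0 (head [::] T) 0 <= i.
Proof.
elim: T => [|r T IHT] //= [r0 Sr [Os Ho] HT]; rewrite rowword_cons mem_cat => /orP[iT|ir].
  apply: leq_trans (IHT HT iT); apply/ltnW/Ho.
  case: (T) HT iT => [|r' T'] /=; first by [].
  by case: r' => // -[].
case: r Sr ir {r0 Os Ho} => // x r /= Sr; rewrite inE => /orP[/eqP->//|].
by move/(allP (order_path_min ltn_trans Sr)) => /ltnW.
Qed.

(** The minimum [c] is in the first row, which ends the row word. The other letters stand to the
    right of [c], so they are in the first row too. *)
Lemma tableau_row_run T c k : is_tableau T -> uniq (rowword T) ->
  all (leq c) (rowword T) -> (forall i, c <= i < c + k -> i \in rowword T) ->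
  (forall i, c <= i -> i.+1 < c + k -> ~~ dsc (rowword T) i) ->
  k <= run_length c (head [::] T).
Proof.
case: k => // k; case: T => [|r T]; first by move=> _ _ _ /(_ c); rewrite /rowword in_nil; lia.
move=> HT U Hc Hin Hd.
have cT : c \in rowword (r :: T) by apply: Hin; lia.
have [r0 Sr Or _] := HT.
have cr : c \in r.
  have := tableau_min HT cT; case: r r0 {Sr Or} Hc {HT U Hin Hd cT} => // x r _.
  rewrite rowword_cons all_cat /= => /and3P[_ cx _] /= xc.
  by rewrite inE; apply/orP; left; lia.
rewrite rowword_cons in U Hc Hin Hd.
have Idx i : i <= k -> index c (rowword T ++ r) <= index (c + i) (rowword T ++ r).
  elim: i => [|i IHi] ik; first by rewrite addn0.
  apply: leq_trans (IHi (ltnW ik)) _; rewrite leqNgt addnS.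
  by apply: Hd; lia.
have T' i : i \in r -> i \notin rowword T.
  move: U; rewrite cat_uniq => /and3P[_ /hasPn H _] /H //.
have Hr i : c <= i < c + k.+1 -> i \in r.
  move=> Hi; have := Idx (i - c); rewrite subnKC; last by lia.
  rewrite !index_cat (negbTE (T' _ cr)).
  have := Hin i Hi; rewrite mem_cat; case: ifP => // iT _ H.
  have : index i (rowword T) < size (rowword T) by rewrite index_mem.
  have H1 : i - c <= k by lia.
  by move=> lt; have := leq_trans lt (leq_trans (leq_addr _ _) (H H1)); rewrite ltnn.
rewrite leq_run_length /=.
have [| -> ->] := take_sorted_iota Sr _ Hr; last by rewrite eqxx.
by move: Hc; rewrite all_cat => /andP[].
Qed.

(* The word inserted by [catabolism m T] for the largest admissible [m]. *)
Definition catabolism_word (b : nat) (T : tableau) : seq nat :=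
  drop (run_length b (head [::] T)) (head [::] T) ++ rowword (behead T).

Section Reduce.
Variables (b : nat) (w : seq nat).
Hypothesis Hw : interval_word b w.
Local Notation T := (insertion_tableau w).
Local Notation r := (head [::] T).
Local Notation z := (run_length b r).

Let HT : is_tableau T := (insertion_tableauP (interval_word_uniq Hw)).1.
Let KT : knuth (rowword T) w := (insertion_tableauP (interval_word_uniq Hw)).2.

Lemma interval_word_rowword : interval_word b (rowword T).
Proof. exact: (interval_word_perm Hw (knuth_perm KT)). Qed.

Lemma rowword_run : rowword T = rowword (behead T) ++ iota b z ++ drop z r.
Proof.
rewrite -run_length_cat; case: (T) => [|r' T'] //=; exact: rowword_cons.
Qed.

Lemma interval_word_catabolism : interval_word (b + z) (catabolism_word b T).
Proof.
rewrite -interval_word_iota_catr.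
apply: (interval_word_perm interval_word_rowword).
by rewrite rowword_run /catabolism_word -catA perm_catC -catA.
Qed.

Lemma run_length_gt0 : w != [::] -> 0 < z.
Proof.
move=> w0; apply: (tableau_row_run HT).
- exact: interval_word_uniq interval_word_rowword.
- exact: interval_word_ge interval_word_rowword.
- move=> i Hi; rewrite (perm_mem (knuth_perm KT)) (mem_interval_word Hw).
  have : 0 < size w by move: w0; case: (w).
  lia.
- by move=> i; lia.
Qed.

Lemma run_length_next : b + z \notin r.
Proof.
apply/negP=> Hz.
have Sr : sorted ltn r by case: (T) HT => //= r' T' [].
have Gr : all (leq b) r.
  have := interval_word_ge interval_word_rowword.
  by case: (T) => //= r' T'; rewrite rowword_cons all_cat => /andP[].
have [|Hs Ht] := @take_sorted_iota b z.+1 r Sr Gr.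
  move=> i; rewrite addnS => /andP[bi]; rewrite ltnS leq_eqVlt => /orP[/eqP->//|Hi].
  by rewrite (run_length_cat b r) mem_cat mem_iota bi Hi.
have := leq_run_length b r z.+1.
by rewrite Hs Ht eqxx ltnn.
Qed.

(** In the row word, the first-row letters after the run have positive labels, because [b + z] lies
    in a lower row and so to the left of [b + z - 1]. Non-zero corotations carry them to the
    front. *)
Lemma halts_catabolism e K ka : noninc (nseq e K) ->
  halts (labels e b w) (nseq e K) ka <->
  halts (labels e b (catabolism_word b T ++ iota b z)) (nseq e K) ka.
Proof.
move=> Hnu; rewrite -(halts_knuth e ka Hnu KT); last first.
- exact: interval_word_ge interval_word_rowword.
- exact: interval_word_uniq interval_word_rowword.
have HR := interval_word_rowword.
rewrite rowword_run catA halts_corotations; first by rewrite /catabolism_word catA.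
  by rewrite -catA -rowword_run.
rewrite -catA -rowword_run; apply/allP => i Hi; rewrite -[0 < _]/(0 < lab b (rowword T) i).
have mT := mem_interval_word HR.
have Ur := interval_word_uniq HR; move: Ur (mT (b + z)) (mT i) (mT b).
rewrite rowword_run !mem_cat !cat_uniq Hi !orbT.
have nz : b + z \notin drop z r by apply: contra run_length_next; exact: mem_drop.
move=> /and3P[_ _ /and3P[_ /hasPn ND _]] Ez Ei Eb.
have bzi : b + z <= i.
  by case/esym/andP: Ei => bi _; have := ND _ Hi; rewrite mem_iota bi /= -leqNgt.
have w0 : w != [::].
  apply/eqP => E0; have := mem_interval_word Hw i.
  rewrite -(perm_mem (knuth_perm KT)) rowword_run !mem_cat Hi !orbT E0 addn0 => /esym/andP[bi ib].
  by have := leq_ltn_trans bi ib; rewrite ltnn.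
have z0 := run_length_gt0 w0.
have bzT : b + z \in rowword (behead T).
  move: Ez; rewrite (negbTE nz) mem_iota ltnn andbF !orbF => ->; rewrite leq_addr /=.
  by case/esym/andP: Ei => _; exact: leq_ltn_trans.
rewrite -rowword_run; apply: (leq_trans _ (leq_lab (rowword T) (leq_addr z b) bzi)).
have -> : b + z = (b + z.-1).+1 by lia.
rewrite labS ?leq_addr // ltn_addl // lt0b /dsc -addnS prednK // rowword_run.
rewrite !index_cat bzT ifF ?(ltn_addr _ _) ?index_mem //.
apply/negbTE; have := interval_word_uniq HR; rewrite rowword_run cat_uniq.
move=> /and3P[_ /hasPn H _]; apply: H; rewrite mem_cat mem_iota; lia.
Qed.
Lemma dsc_run k : b <= k -> k.+1 < b + z -> ~~ dsc w k.
Proof.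
move=> bk kz; have U := interval_word_uniq interval_word_rowword.
rewrite -(knuth_dsc KT U) rowword_run /dsc !index_cat.
have NB i : b <= i < b + z -> i \in rowword (behead T) = false.
  move=> Hi; apply/negbTE; move: U; rewrite rowword_run cat_uniq.
  by move=> /and3P[_ /hasPn H _]; apply: H; rewrite mem_cat mem_iota Hi.
rewrite !NB ?mem_iota; try lia.
by rewrite !ifT ?index_in_iota; lia.
Qed.

Lemma mem_run i : b <= i < b + z -> i \in w.
Proof.
move=> Hi; rewrite -(perm_mem (knuth_perm KT)) rowword_run !mem_cat mem_iota Hi.
by rewrite orbT.
Qed.

End Reduce.

(* Greedy catabolisms produce a partition. *)
Lemma run_length_decreasing b w : interval_word b w ->
  run_length (b + run_length b (head [::] (insertion_tableau w)))
    (head [::] (insertion_tableau (catabolism_word b (insertion_tableau w)))) <=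
  run_length b (head [::] (insertion_tableau w)).
Proof.
move=> Hw; set T := insertion_tableau w; set z := run_length b (head [::] T); have Hc := interval_word_catabolism Hw; rewrite -/T -/z in Hc *.
set cw := catabolism_word b T in Hc *; set z' := run_length _ _.
rewrite leqNgt; apply/negP => zz'.
have HT : is_tableau T := (insertion_tableauP (interval_word_uniq Hw)).1.
have UT := interval_word_uniq (interval_word_rowword Hw); rewrite -/T in UT.
have cr := run_length_next Hw; rewrite -/T -/z in cr.
have Ecw : cw = drop z (head [::] T) ++ rowword (behead T) by [].
have GB : all (leq (b + z)) (rowword (behead T)).
  by have := interval_word_ge Hc; rewrite Ecw all_cat => /andP[].
have cd : b + z \notin drop z (head [::] T) by apply: contra cr; exact: mem_drop.
(* If [z < z'], the next run has no inverse descent in [cw], so [b + z] is its leftmost letter. It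
   comes from the lower rows, which end [cw]; hence the whole run does, and it opens the second
   row. *)
have Ic i : i < z' -> index (b + z) cw <= index (b + z + i) cw.
  elim: i => [|i IHi] iz'; first by rewrite addn0.
  apply: leq_trans (IHi (ltnW iz')) _; rewrite leqNgt addnS.
  by apply: (dsc_run Hc); rewrite -/z'; lia.
have nd i : b + z <= i < b + z + z' -> i \notin drop z (head [::] T).
  move=> Hi; apply/negP => id; have := Ic (i - (b + z)); rewrite subnKC; last by lia.
  rewrite Ecw !index_cat id (negbTE cd) => H.
  have lt : index i (drop z (head [::] T)) < size (drop z (head [::] T)).
    by rewrite index_mem.
  have H1 : i - (b + z) < z' by lia.
  by have := leq_trans lt (leq_trans (leq_addr _ _) (H H1)); rewrite ltnn.
have inB i : b + z <= i < b + z + z' -> i \in rowword (behead T).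
  move=> Hi; have := mem_run Hc Hi; rewrite -/cw Ecw mem_cat.
  by rewrite (negbTE (nd _ Hi)).
have : z' <= run_length (b + z) (head [::] (behead T)).
  apply: tableau_row_run => //.
  - by case: (T) HT => //= r T' [].
  - by move: UT; case: (T) => //= r T'; rewrite rowword_cons cat_uniq => /and3P[].
  - move=> i Hi1 Hi2; have := dsc_run Hc Hi1 Hi2; rewrite -/cw Ecw /dsc !index_cat.
    by rewrite (negbTE (nd i _)) ?(negbTE (nd i.+1 _)) ?ltn_add2l //; lia.
rewrite leq_run_length => /andP[Hs /eqP Ht].
have [Os Ho] : above (head [::] T) (head [::] (behead T)).
  by case: (T) HT => //= r T' [].
(* [x] lies above [b + z + z], the entry of column [z] of the second row. So it is a letter of the
   next run that stays in the first row, a contradiction. *)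
set x := nth 0 (head [::] T) z.
have xd : x \in drop z (head [::] T).
  rewrite /x -[z in nth _ _ z]addn0 -nth_drop mem_nth // size_drop subn_gt0.
  exact: leq_trans zz' (leq_trans Hs Os).
have xlt : x < b + z + z.
  have := Ho z (leq_trans zz' Hs).
  by rewrite -(nth_take 0 zz' (head [::] (behead T))) Ht nth_iota.
have : b + z <= x by apply: (allP (interval_word_ge Hc)); rewrite -/cw Ecw mem_cat xd.
by move=> xge; move: xd; apply/negP/nd; lia.
Qed.

(** * Prefixing a smallest letter, and the output as greedy catabolisms *)

Definition cons_first_row (b : nat) (T : tableau) : tableau :=
  (b :: head [::] T) :: behead T.

Lemma cons_first_row_insert b T x : b < x ->
  row_insert (cons_first_row b T) x = cons_first_row b (row_insert T x).
Proof.
move=> bx; have nxb : ltn x b = false by rewrite /= ltnNge ltnW.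
by case: T => [|r T]; rewrite /cons_first_row /= ltnNge ltnW.
Qed.

Lemma insertion_tableau_min b R : all (ltn b) R ->
  insertion_tableau (b :: R) = cons_first_row b (insertion_tableau R).
Proof.
rewrite /insertion_tableau /= -[[:: [:: b]]]/(cons_first_row b [::]).
elim: R [::] => [//|x R IHR] T /andP[bx HR].
rewrite -[LHS]/(foldl row_insert (row_insert (cons_first_row b T) x) R).
by rewrite cons_first_row_insert // IHR.
Qed.

Lemma catabolism_word_cons_first_row b T :
  catabolism_word b (cons_first_row b T) = catabolism_word b.+1 T.
Proof. by rewrite /catabolism_word /= eqxx. Qed.

Lemma size_catabolism_word b w : interval_word b w -> w != [::] ->
  size (catabolism_word b (insertion_tableau w)) < size w.
Proof.
move=> Hw w0; have [_ K] := insertion_tableauP (interval_word_uniq Hw).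
rewrite -(perm_size (knuth_perm K)) (rowword_run b w) /catabolism_word !size_cat size_iota.
by rewrite addnC ltn_add2l -[ltnLHS]add0n ltn_add2r; exact: run_length_gt0.
Qed.

Lemma noninc_nseq e K : e <= 1 -> noninc (nseq e K).
Proof. by case: e => [|[|e]] // _ [|i] //=; rewrite ?nth_nil. Qed.

(** Termination and the recursion for the output, by induction on length. The zero labels fill the
    first row with [z] cells; what remains is the run of the catabolism word one row lower, and
    [run_length_decreasing] gives the bound for [halts_shift]. *)
Lemma output_cons b w : interval_word b w -> w != [::] ->
  exists ka, let z := run_length b (head [::] (insertion_tableau w)) in
    [/\ output b w (z :: ka),
        output (b + z) (catabolism_word b (insertion_tableau w)) ka & head 0 ka <= z].
Proof.
move En: (size w) => n; elim/ltn_ind: n b w En => n IHn b w En Hw w0.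
set T := insertion_tableau w; set z := run_length b (head [::] T).
have Hc := interval_word_catabolism Hw; rewrite -/T -/z in Hc.
have z0 : 0 < z := run_length_gt0 Hw w0.
have [ka [Hka hka]] : exists ka, output (b + z) (catabolism_word b T) ka /\ head 0 ka <= z.
  have [c0|c0] := eqVneq (catabolism_word b T) [::].
    by exists [::]; rewrite c0; split=> //; apply/halts_nil.
  have Hn : size (catabolism_word b T) < n by rewrite -En; exact: size_catabolism_word.
  have [ka [Hka _ _]] := IHn _ Hn _ _ erefl Hc c0.
  by eexists; split; [exact: Hka | exact: run_length_decreasing].
exists ka; split=> //.
rewrite /output (halts_catabolism Hw (e := 0) (K := 0)); last exact: noninc_nseq.
apply/(output_iota_catr _ z0 Hc).
by rewrite -labels_map_S; apply: halts_shift.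
Qed.

Lemma output_inj b w ka ka' : output b w ka -> output b w ka' -> ka = ka'.
Proof. exact: halts_inj. Qed.

Lemma output_exists b w : interval_word b w -> exists ka, output b w ka.
Proof.
move=> Hw; have [->|w0] := eqVneq w [::]; first by exists [::]; apply/halts_nil.
by have [ka [H _ _]] := output_cons Hw w0; eexists; exact: H.
Qed.

Definition dominated (la mu : seq nat) : Prop :=
  forall k, sumn (take k la) <= sumn (take k mu).

(** The greedy catabolisms of [b :: R] and [R] leave the same word, so the outputs differ only by
    one cell in the first part. *)
Lemma output_min b R ka ka' : interval_word b.+1 R ->
  output b (b :: R) ka -> output b.+1 R ka' ->
  forall k, sumn (take k ka) <= (sumn (take k ka')).+1.
Proof.
move=> HR H H'; have Hb : interval_word b (b :: R) by rewrite interval_word_cons.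
have [ka1 [H1 H1' _]] := output_cons Hb isT.
rewrite insertion_tableau_min in H1 H1'; last exact: interval_word_ge HR.
rewrite catabolism_word_cons_first_row /= eqxx in H1 H1'.
rewrite (output_inj H H1) {H H1}.
have [R0|R0] := eqVneq R [::].
  move: H1'; rewrite R0 /= => /halts_nil->.
  by case=> //= k; rewrite addn0.
have [ka2 [H2 H2' _]] := output_cons HR R0.
rewrite (output_inj H' H2) {H' H2}; rewrite addnS -addSn in H1'.
rewrite (output_inj H1' H2') => -[|k] //=.
Qed.

(** * The output is the catabolizability *)

Lemma output_iota b j R ka ka' : interval_word (b + j) R ->
  output b (iota b j ++ R) ka -> output (b + j) R ka' ->
  forall k, sumn (take k ka) <= j + sumn (take k ka').
Proof.
elim: j b ka => [|j IHj] b ka.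
  by rewrite addn0 => _ /= /output_inj H /H ->.
rewrite addnS -addSn => HR H H' k.
have HR' : interval_word b.+1 (iota b.+1 j ++ R) by rewrite interval_word_iota_catl.
have [ka1 H1] := output_exists HR'.
have := output_min HR' H H1 k; have := IHj _ _ HR H1 H' k; lia.
Qed.

Lemma smallest_entriesE b w m : interval_word b w ->
  smallest_entries m (insertion_tableau w) = take m (iota b (size w)).
Proof.
move=> Hw; rewrite /smallest_entries; congr take.
have [_ K] := insertion_tableauP (interval_word_uniq Hw).
apply: (sorted_eq leq_trans anti_leq).
- exact: (sort_sorted leq_total).
- exact: iota_sorted.
- by rewrite perm_sort; exact: perm_trans (knuth_perm K) Hw.
Qed.

Lemma smallest_entries_run b w m : interval_word b w ->
  (m <= size (head [::] (insertion_tableau w))) &&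
    all (fun x => x \in take m (head [::] (insertion_tableau w)))
      (smallest_entries m (insertion_tableau w)) =
  (m <= run_length b (head [::] (insertion_tableau w))).
Proof.
move=> Hw; set T := insertion_tableau w; set r := head [::] T; rewrite leq_run_length (smallest_entriesE m Hw).
have [HT K] := insertion_tableauP (interval_word_uniq Hw).
have HR := interval_word_rowword Hw; rewrite -/T in HT K HR.
have [mr|//] := boolP (m <= size r) => /=.
have mw : m <= size w.
  apply: leq_trans mr _; rewrite -(perm_size (knuth_perm K)).
  by rewrite /r; case: (T) => //= r' T'; rewrite rowword_cons size_cat leq_addl.
rewrite take_iota (minn_idPl mw); apply/idP/eqP => [/allP H|->]; last by apply/allP.
have Sr : sorted ltn r by rewrite /r; case: (T) HT => //= ? ? [].
have Gr : all (leq b) r.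
  have := interval_word_ge HR.
  by rewrite /r; case: (T) => //= r' T'; rewrite rowword_cons all_cat => /andP[].
have [|_ ->//] := @take_sorted_iota b m r Sr Gr.
by move=> i Hi; apply: (@mem_take m); apply: H; rewrite mem_iota.
Qed.

(** A first part [m] below the greedy [z] leaves [z - m] letters of the run in front of the greedy
    word. By [output_iota] they raise later partial sums by at most [z - m], which only makes up for
    the loss. *)
Lemma catabolizable_dominated b w mu ka : interval_word b w -> 0 \notin mu ->
  catabolizable mu (insertion_tableau w) -> output b w ka -> dominated mu ka.
Proof.
elim: mu b w ka => [|m mu IHmu] b w ka Hw; first by move=> _ _ _ [].
rewrite inE negb_or => /andP[m0 mu0] /=; rewrite andbA (smallest_entries_run _ Hw).
set T := insertion_tableau w; set z := run_length b (head [::] T).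
move=> /andP[mz Hmu] Hka.
have w0 : w != [::].
  by apply: contraNneq m0 => w0; move: mz; rewrite /z /T w0 /= leqn0 eq_sym.
have Hc := interval_word_catabolism Hw; rewrite -/T -/z in Hc.
have [ka1 [H1 H1' _]] := output_cons Hw w0; rewrite -/T -/z in H1 H1'.
rewrite (output_inj Hka H1) {Hka H1}.
have Em : drop m (head [::] T) ++ rowword (behead T) =
          iota (b + m) (z - m) ++ catabolism_word b T.
  rewrite /catabolism_word -/z catA {1}(run_length_cat b (head [::] T)) -/z.
  by rewrite drop_cat size_iota drop_iota; case: ltngtP mz => // ->; rewrite subnn drop0.
rewrite /catabolism Em in Hmu.
have Hc' : interval_word (b + m + (z - m)) (catabolism_word b T).
  by rewrite -addnA subnKC.
have Hm : interval_word (b + m) (iota (b + m) (z - m) ++ catabolism_word b T).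
  by rewrite interval_word_iota_catl.
have [ka2 H2] := output_exists Hm.
have {}H1' : output (b + m + (z - m)) (catabolism_word b T) ka1.
  by rewrite -addnA subnKC.
have I := output_iota Hc' H2 H1'.
have J := IHmu _ _ _ Hm mu0 Hmu H2.
by case=> [//|k] /=; have := I k; have := J k; lia.
Qed.

Lemma output_catabolizable b w ka : interval_word b w -> output b w ka ->
  is_partition (size w) ka /\ catabolizable ka (insertion_tableau w).
Proof.
move En: (size w) => n; elim/ltn_ind: n b w ka En => n IHn b w ka En Hw Hka.
have [w0|w0] := eqVneq w [::].
  by move: Hka En; rewrite w0 => /halts_nil-> <-.
have [ka1 [H1 H1' hka]] := output_cons Hw w0; rewrite (output_inj Hka H1) {Hka}.
have Hn : size (catabolism_word b (insertion_tableau w)) < n.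
  by rewrite -En; exact: size_catabolism_word.
have [/and3P[S1 N1 /eqP Z1] C1] := IHn _ Hn _ _ _ erefl (interval_word_catabolism Hw) H1'.
split; last first.
  by rewrite /= andbA (smallest_entries_run _ Hw) leqnn.
apply/and3P; split.
- by case: (ka1) hka S1 => //= x s xz ->; rewrite andbT.
- by rewrite inE negb_or N1 eq_sym -lt0n run_length_gt0.
rewrite /= Z1 -En; have [_ K] := insertion_tableauP (interval_word_uniq Hw).
rewrite -(perm_size (knuth_perm K)) (rowword_run b) /catabolism_word !size_cat size_iota.
by apply/eqP; rewrite addnA addnC addnA.
Qed.

Lemma dominated_anti la mu : 0 \notin la -> 0 \notin mu ->
  dominated la mu -> dominated mu la -> la = mu.
Proof.
elim: la mu => [|x la IHla] [|y mu] //.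
- by rewrite inE negb_or => _ /andP[y0 _] _ /(_ 1) /=; lia.
- by rewrite inE negb_or => /andP[x0 _] _ /(_ 1) /=; lia.
rewrite !inE !negb_or => /andP[_ l0] /andP[_ m0] lm ml.
have Exy : x = y by apply/eqP; move: (lm 1) (ml 1); rewrite /= !take0 !addn0 eqn_leq => -> ->.
rewrite Exy in lm ml *; congr (_ :: _); apply: IHla => // k.
  by have := lm k.+1; rewrite /= leq_add2l.
by have := ml k.+1; rewrite /= leq_add2l.
Qed.

(** The output is itself catabolizable and dominates every other choice, hence is the only maximal
    one. *)
Lemma ctypeE b w ka : interval_word b w -> output b w ka -> ctype w = ka.
Proof.
move=> Hw Hka; have [Pka Cka] := output_catabolizable Hw Hka.
have [_ K] := insertion_tableauP (interval_word_uniq Hw).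
have Es : size (rowword (insertion_tableau w)) = size w := perm_size (knuth_perm K).
have Hmax : maximal_catabolizable (insertion_tableau w) ka.
  split; first by split; rewrite ?Es.
  move=> mu [/and3P[_ mu0 _] Cmu] [_ Dmu]; apply: dominated_anti => //.
    by case/and3P: Pka.
  exact: catabolizable_dominated Hw mu0 Cmu Hka.
rewrite /ctype /ctype_tableau; apply: xget_unique => // la [[]].
rewrite Es => /and3P[Sla la0 /eqP Zla] Cla Mla.
apply/esym/Mla; first by split; rewrite ?Es.
split; last exact: catabolizable_dominated Hw la0 Cla Hka.
by rewrite Zla; case/and3P: Pka => _ _ /eqP.
Qed.

(** * Zero corotations *)

Lemma lab_eq0_dsc b w i k : lab b w i = 0 -> b <= k -> k < i -> ~~ dsc w k.
Proof.
move=> L0 bk ki; have := leq_lab w (leqW bk) ki.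
by rewrite L0 labS //; case: (dsc w k) => //; lia.
Qed.

Lemma lab_gt0 b w a : b < a -> dsc w a.-1 -> 0 < lab b w a.
Proof. by case: a => // a ba /= d; rewrite labS // d addn1. Qed.

Lemma lab_iota b j R i : interval_word (b + j) R -> i < b + j ->
  lab b (R ++ iota b j) i = 0.
Proof.
move=> HR Hi; have mR := mem_interval_word HR.
by apply: lab0 => k bk ki; rewrite /dsc !index_cat !mR !ifF ?index_in_iota //; lia.
Qed.

Lemma halts_head_pos q x nu ka : all (leq 1) q -> halts q (x :: nu) ka -> head 0 ka = x.
Proof.
move=> + [n]; elim: n q x nu => [|n IHn] q x nu; first by move=> _ [_ <-].
rewrite iterSr /step; case: q => [|a q] /=; first by move=> _; exact: IHn.
case/andP=> a0 Hq; case: ifP => _; last by apply: IHn; rewrite all_rcons.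
by case: a a0 => // a _; exact: IHn.
Qed.

Lemma labels_pos e b w : all (leq e) (labels e b w).
Proof. by rewrite /labels all_rev all_map; apply/allP => i _; exact: leq_addr. Qed.

Lemma iota_rcons c m : iota c m.+1 = rcons (iota c m) (c + m).
Proof. by rewrite -addn1 iotaD cats1. Qed.

(** Weak dominance for words of length [n], stated by length to serve as induction hypothesis. *)
Definition zero_corotation_dominated (n : nat) : Prop :=
  forall b w a ka ka', size (rcons w a) = n -> interval_word b (rcons w a) ->
    b < a -> lab b (rcons w a) a = 0 ->
    output b (rcons w a) ka -> output b (a :: w) ka' -> dominated ka' ka.

(** The letters from [c + k + j - 1] down to [c + k] move to the front one at a time. The rest of
    the run stays at the end with label 0, and [0 < k] keeps the moved letter different from [c]. *)
Lemma zero_corotations_dominated n c k j R ka ka' : zero_corotation_dominated n ->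
  0 < k -> size R + (k + j) = n -> interval_word (c + (k + j)) R ->
  output c (R ++ iota c (k + j)) ka ->
  output c (iota (c + k) j ++ R ++ iota c k) ka' -> dominated ka' ka.
Proof.
move=> Z k0; elim: j R ka => [|j IHj] R ka.
  by rewrite !addn0 /= => _ _ H /output_inj /(_ H) ->.
rewrite addnS iota_rcons -rcons_cat => En HR Hka Hka'.
have HR' : interval_word c (rcons (R ++ iota c (k + j)) (c + (k + j))).
  by rewrite rcons_cat -iota_rcons interval_word_iota_catr.
have HxR : interval_word (c + (k + j)) ((c + (k + j)) :: R).
  by rewrite interval_word_cons -addnS.
have [ka1 H1] : exists ka1, output c ((c + (k + j) :: R) ++ iota c (k + j)) ka1.
  by apply: output_exists; rewrite interval_word_iota_catr.
have D1 : dominated ka1 ka.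
  apply: Z HR' _ _ Hka H1.
  - by rewrite size_rcons size_cat size_iota -addnS.
  - by lia.
  - by rewrite rcons_cat -iota_rcons lab_iota // addnS.
have D2 : dominated ka' ka1.
  apply: IHj H1 _ => //; first by rewrite /= -En; lia.
  by rewrite iota_rcons cat_rcons -addnA in Hka'.
by move=> i; exact: leq_trans (D2 i) (D1 i).
Qed.

(* If [X] has more than [k] zero labels, the surplus ones do not fit below a first
   row of length [k]; they are put back exactly as by zero corotations of [X]. *)
Lemma halts_bounded n c k X ka ka' : zero_corotation_dominated n -> 0 < k ->
  size X = n -> interval_word c X -> output c X ka ->
  halts (labels 1 c X) [:: k] ka' ->
  exists2 ka2, ka' = k :: ka2 & dominated ka2 ka.
Proof.
move=> Z k0 En HX Hka Hka'.
have [X0|X0] := eqVneq X [::].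
  by move: Hka Hka'; rewrite X0 => _ /halts_nil->; exists [::].
have [ka1 [H1 H1' _]] := output_cons HX X0.
set T := insertion_tableau X in H1 H1'; set z := run_length _ _ in H1 H1'.
(* If [z <= k], the whole output of [X] fits below a row of length [k]. *)
have [zk|kz] := leqP z k.
  have := halts_shift (K := k) H1 zk; rewrite labels_map_S => H.
  exists (z :: ka1); first exact: halts_inj Hka' H.
  by rewrite (output_inj Hka H1).
have Hc := interval_word_catabolism HX; rewrite -/T -/z in Hc.
set cw := catabolism_word c T in Hc H1'.
have z0 : 0 < z := ltn_trans k0 kz.
move: Hka'; rewrite (halts_catabolism HX (e := 1) (K := k)); last exact: noninc_nseq.
rewrite -/T -/z -/cw labels_iota_catr // halts_ones_cut // ?(ltnW kz) // => Hka'.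
have HL : interval_word (c + k) (iota (c + k) (z - k) ++ cw).
  by rewrite interval_word_iota_catl -addnA subnKC // ltnW.
(* This word arises from [cw ++ iota c z] by [z - k] zero corotations. Below a row of length [k],
   its run reaches the present state once [k] cells are in the second row. *)
have [ka0 H0] : exists ka0, output c ((iota (c + k) (z - k) ++ cw) ++ iota c k) ka0.
  by apply: output_exists; rewrite interval_word_iota_catr.
exists ka0.
  have := H0; rewrite output_iota_catr // => H.
  have hk : head 0 ka0 <= k by rewrite (halts_head_pos (labels_pos _ _ _) H).
  have := halts_shift H hk; rewrite labels_map_S labels_iota_catl; last first.
    by rewrite -addnA subnKC // ltnW.
  by rewrite -addnA subnKC ?(ltnW kz) // => /(halts_inj Hka').
move: Hka; rewrite /output (halts_catabolism HX (e := 0) (K := 0)); last exact: noninc_nseq.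
rewrite -/T -/z -/cw -(subnKC (ltnW kz)) => Hka.
rewrite -catA in H0; apply: (zero_corotations_dominated Z k0 _ _ Hka) => //.
- rewrite -En subnKC ?(ltnW kz) //.
  have [_ K] := insertion_tableauP (interval_word_uniq HX).
  rewrite -(perm_size (knuth_perm K)) (rowword_run c) -/T -/z /cw /catabolism_word.
  by rewrite !size_cat size_iota -addnA addnC -addnA.
- by rewrite subnKC // ltnW.
Qed.

Lemma run_length_iota_cat b j s : run_length b (iota b j ++ s) = j + run_length (b + j) s.
Proof. by elim: j b => [|j IHj] b /=; rewrite ?addn0 // eqxx IHj addnS -addSn. Qed.

Lemma run_length_notin b s : b \notin s -> run_length b s = 0.
Proof. by case: s => //= x s; rewrite inE eq_sym; case: eqP. Qed.

Lemma row_insert_run b k s T : path ltn (b + k) s ->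
  row_insert ((iota b k ++ s) :: T) (b + k) =
  (iota b k.+1 ++ behead s) :: (if s is y :: _ then row_insert T y else T).
Proof.
move=> Ps.
have Ef : find (ltn (b + k)) (iota b k ++ s) = k.
  rewrite find_cat ifF ?size_iota; last first.
    by apply/hasP=> -[x]; rewrite mem_iota /=; lia.
  by case: s Ps => [|y s] /=; rewrite ?addn0 // => /andP[-> _]; rewrite addn0.
case: s Ef Ps => [|y s] Ef _.
  rewrite !cats0 in Ef *; rewrite iota_rcons /= Ef size_iota ltnn.
  by rewrite set_nthE size_iota ltnn subnn /= cats1.
have ks : k < size (iota b k ++ y :: s) by rewrite size_cat size_iota /= addnS ltnS leq_addr.
rewrite iota_rcons cat_rcons /= Ef ks nth_cat size_iota ltnn subnn /=.
rewrite set_nthE ks take_size_cat ?size_iota // drop_cat size_iota ltnNge leqnSn /=.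
by rewrite subSnn /= drop0.
Qed.

(** The first row of the tableau of [w] is [b, ..., a - 1] followed by some [s] beyond [a].
    Inserting [a] gives [wa] the first part [k + 1], while [aw] only gets [k]; the later parts gain
    at most one in partial sums. *)
Lemma zero_corotation_strict n b w a ka ka' :
  (forall m, m < n -> zero_corotation_dominated m) ->
  size (rcons w a) = n -> interval_word b (rcons w a) ->
  b < a -> lab b (rcons w a) a = 0 ->
  output b (rcons w a) ka -> output b (a :: w) ka' -> dominated ka' ka /\ ka' <> ka.
Proof.
move=> Z En Hu; set k := a - b => ba La Hka Hka'.
have k0 : 0 < k by rewrite /k; lia.
have Ea : b + k = a by rewrite /k; lia.
have := interval_word_uniq Hu; rewrite rcons_uniq => /andP[aw Uw].
have mu := mem_interval_word Hu.
have au : b <= a < b + n by rewrite -En -mu mem_rcons mem_head.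
have mw i : i != a -> b <= i < b + n -> i \in w.
  by move=> ia; rewrite -En -mu mem_rcons inE (negbTE ia).
have Gw : all (leq b) w.
  by have := interval_word_ge Hu; rewrite all_rcons => /andP[].
have [HS KS] := insertion_tableauP Uw; set S := insertion_tableau w in HS KS.
have US : uniq (rowword S) by rewrite (perm_uniq (knuth_perm KS)).
(* Label 0 of [a] excludes inverse descents among [b, ..., a - 1], so these letters open the first
   row. *)
have kr : k <= run_length b (head [::] S).
  apply: (tableau_row_run HS US).
  - by rewrite (perm_all _ (knuth_perm KS)).
  - by move=> i Hi; rewrite (perm_mem (knuth_perm KS)); apply: mw; lia.
  move=> i Hi1 Hi2; rewrite (knuth_dsc KS US).
  have := lab_eq0_dsc La Hi1 (ltnW (_ : i.+1 < a)); rewrite -Ea => /(_ Hi2).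
  by rewrite /dsc -cats1 !index_cat !mw //; lia.
have [r [S' ES]] : exists r S', S = r :: S'.
  by case: (S) kr => [|r S' _]; [rewrite leqn0; lia | exists r, S'].
rewrite ES /= in HS KS US kr.
have [s Er] : exists s, r = iota b k ++ s.
  exists (drop k r); move: kr; rewrite leq_run_length => /andP[_ /eqP<-].
  by rewrite cat_take_drop.
have [_ Sr _ HS'] := HS.
rewrite rowword_cons Er in KS US; set B := rowword S' in KS US.
have sa i : i \in s -> a < i.
  move=> Hi.
  have iw : i \in w by rewrite -(perm_mem (knuth_perm KS)) !mem_cat Hi !orbT.
  have := allP Gw _ iw; have : i != a by apply: contraNneq aw => <-.
  move: US; rewrite cat_uniq => /and3P[_ _]; rewrite cat_uniq => /and3P[_ /hasPn H _].
  by have := H _ Hi; rewrite mem_iota Ea; lia.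
have Ps : path ltn a s.
  have : sorted ltn s by move: Sr; rewrite Er; exact: (subseq_sorted ltn_trans (suffix_subseq _ _)).
  by case: (s) sa => //= x s' H ->; rewrite H ?mem_head.
have Ew : rowword (r :: S') = B ++ iota b k ++ s by rewrite rowword_cons Er.
have HT : insertion_tableau (rcons w a) =
    (iota b k.+1 ++ behead s) :: (if s is y :: _ then row_insert S' y else S').
  by rewrite insertion_tableau_rcons -/S ES Er -{1}Ea row_insert_run // Ea.
have Erl : run_length b (head [::] (insertion_tableau (rcons w a))) = k.+1.
  rewrite HT -[head _ _]/(iota b k.+1 ++ behead s) run_length_iota_cat.
  rewrite run_length_notin ?addn0 // addnS Ea; apply/negP.
  case: (s) Ps => //= y s' /andP[ay Py] /(allP (order_path_min ltn_trans Py)) /=; lia.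
have Ecw : catabolism_word b (insertion_tableau (rcons w a)) =
    behead s ++ rowword (if s is y :: _ then row_insert S' y else S').
  rewrite /catabolism_word Erl HT -[head _ _]/(iota b k.+1 ++ behead s).
  by rewrite drop_size_cat ?size_iota.
have u0 : rcons w a != [::] by case: (w).
have [ka2 [H1 H2 _]] := output_cons Hu u0.
rewrite Ecw Erl addnS Ea in H2; rewrite Erl in H1.
rewrite (output_inj Hka H1) {Hka H1 ka}.
have Kv : knuth (a :: w) (a :: B ++ iota b k ++ s).
  exact/knuth_sym/(@knuth_catl [:: a])/KS.
have Hv : interval_word b (a :: w).
  by apply: (interval_word_perm Hu); rewrite perm_sym perm_rcons.
have HV : interval_word b ((a :: B ++ iota b k) ++ s).
  by apply: (interval_word_perm Hv); rewrite /= -catA perm_sym; exact: knuth_perm Kv.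
have HX : interval_word a (s ++ a :: B).
  rewrite -Ea -interval_word_iota_catr Ea; apply: (interval_word_perm HV).
  by rewrite -catA perm_catC.
have EX : size (s ++ a :: B) < n.
  by rewrite -En size_rcons -(perm_size (knuth_perm KS)) !size_cat size_iota /=; lia.
move: Hka'; rewrite /output (halts_knuth 0 _ (@noninc_nseq 0 0 isT) Kv); last first.
- exact: interval_word_ge Hv.
- exact: interval_word_uniq Hv.
(* With [a] in front of [a - 1], all letters of [s] have positive labels and can be corotated to the
   front. *)
rewrite -[a :: B ++ _ ++ _]/((a :: B) ++ (iota b k ++ s)) catA.
rewrite (halts_corotations 0 0 _ HV); last first.
  apply/allP=> i /sa ai /=; apply: (leq_trans _ (leq_lab _ (ltnW ba) (ltnW ai))).
  apply: lab_gt0 => //; rewrite /dsc (ltn_predK ba) /= eqxx; case: eqP => // E1.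
  by have := ltn_predK ba; rewrite -E1; lia.
move=> Hka'; have {}Hka' : output b ((s ++ a :: B) ++ iota b k) ka' by rewrite -catA.
have {}Hka' : halts (labels 1 a (s ++ a :: B)) [:: k] ka'.
  by rewrite -Ea -output_iota_catr ?Ea.
have [kx Hx] := output_exists HX.
have [k2 -> D2] := halts_bounded (Z _ EX) k0 erefl HX Hx Hka'.
split; last by case=> /esym/eqP; rewrite eqn_leq ltnn.
suff Dx i : sumn (take i kx) <= (sumn (take i ka2)).+1.
  by case=> //= i; rewrite addSnnS leq_add2l; exact: leq_trans (D2 i) (Dx i).
case: s {Er Ew HT Erl Ecw HV Hka' KS US Kv} sa Ps HX EX Hx H2 => [|y s] sa Ps HX EX Hx H2.
  by apply: (output_min _ Hx H2); rewrite -interval_word_cons.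
move: Ps; rewrite /= => /andP[ay Py].
have HE : interval_word a (rcons (a :: s ++ B) y).
  apply: (interval_word_perm HX); rewrite perm_rcons /= perm_cons perm_sym.
  by rewrite -[a :: B]cat1s -[a :: s ++ B]cat1s perm_catCA.
have HR : interval_word a.+1 (rcons (s ++ B) y) by rewrite -interval_word_cons.
(* Up to Knuth moves, the words to compare are [y a s B] and [s B y]; the intermediate word is
   [a s B y]. *)
have KX : knuth ((y :: s) ++ a :: B) (y :: a :: s ++ B).
  by rewrite -cat_rcons; exact: (knuth_catr B (knuth_pull_right ay Py)).
have KR : knuth (s ++ rowword (row_insert S' y)) (rcons (s ++ B) y).
  rewrite rcons_cat; apply/knuth_catl/knuth_row_insert => //.
  have := interval_word_uniq HR; rewrite rcons_cat cat_uniq.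
  by case/and3P.
have {}H2 : output a.+1 (rcons (s ++ B) y) ka2.
  move: H2; rewrite /output /= -(halts_knuth 0 _ (@noninc_nseq 0 0 isT) (knuth_sym KR)) //.
  - exact: interval_word_uniq HR.
  - exact: interval_word_ge HR.
have {}Hx : output a (y :: a :: s ++ B) kx.
  move: Hx; rewrite /output (halts_knuth 0 _ (@noninc_nseq 0 0 isT) KX) //.
  - exact: interval_word_uniq HX.
  - exact: interval_word_ge HX.
have [ke He] := output_exists HE.
have Dxe : dominated kx ke.
  (* Moving [y] to the front is a corotation of a word shorter than [n]: the induction hypothesis
     covers label 0, and otherwise the output is unchanged. *)
  have [L0|Lpos] := posnP (lab a (rcons (a :: s ++ B) y) y).
    by apply: (Z _ EX _ _ _ _ _ _ HE ay L0 He Hx); rewrite size_rcons /= !size_cat /= addnS.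
  have H := He; rewrite /output (halts_corotation 0 0 _ HE Lpos) in H.
  by rewrite (output_inj Hx H).
exact: leq_trans (Dxe i) (output_min HR He H2 i).
Qed.

Lemma zero_corotationP n : zero_corotation_dominated n.
Proof.
elim/ltn_ind: n => n IHn b w a ka ka' En Hw ba La Hka Hka'.
by have [] := zero_corotation_strict IHn En Hw ba La Hka Hka'.
Qed.

(** * Corotations of standard words *)

Lemma cocharge_labelE w i : cocharge_label w i = lab 1 w i.
Proof.
elim: i => [|[|i] IHi]; [by rewrite lab_geq | by rewrite lab_geq |].
by rewrite labS // -IHi.
Qed.

Theorem corollary3p14 (u v : seq nat)
    (hu : standard_word u) (hv : standard_word v) :
  (nonzero_corotation u v -> ctype v = ctype u) /\
  (zero_corotation u v -> dominance_lt (ctype v) (ctype u)).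
Proof.
have [ku Hku] := output_exists (hu : interval_word 1 u).
have [kv Hkv] := output_exists (hv : interval_word 1 v).
rewrite (ctypeE hu Hku) (ctypeE hv Hkv); split=> -[w [a [a1 Hw Eu Ev]]].
  rewrite cocharge_labelE => La; move: Hku Hkv; rewrite Eu Ev => Hku Hkv.
  by move: Hku; rewrite /output (halts_corotation 0 0 _ Hw La) => /(halts_inj Hkv).
rewrite cocharge_labelE => La; move: Hku Hkv; rewrite Eu Ev => Hku Hkv.
have ba : 1 < a.
  have := mem_interval_word (Hw : interval_word 1 _) a.
  by rewrite mem_rcons mem_head => /esym/andP[]; lia.
have [D ne] := zero_corotation_strict (fun m _ => @zero_corotationP m) erefl Hw ba La Hku Hkv.
split=> //; split=> //.
rewrite Eu in hu; rewrite Ev in hv.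
have [/and3P[_ _ /eqP->] _] := output_catabolizable (hu : interval_word 1 _) Hku.
have [/and3P[_ _ /eqP->] _] := output_catabolizable (hv : interval_word 1 _) Hkv.
by rewrite size_rcons.
Qed.
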